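(* Let $n\ge 1$, let $\mathcal{C}\subset(\mathbb{F}_2)^n$ be a doubly even code, and let $\theta\colon\mathcal{C}\times\mathcal{C}\to\mathbb{F}_2$ be a code cocycle on $\mathcal{C}$. Let $\mathcal{C}=V\oplus W$ be a decomposition of $\mathcal{C}$ into complementary linear subspaces. Then for all $v_1,v_2\in V$ and $w_1,w_2\in W$, \begin{align*} \theta(v_1+w_1,\,v_2+w_2) \equiv{}& \theta(v_1,v_2)+\theta(w_1,w_2)+\theta(v_1,w_1)+\theta(w_2,v_2)+\theta(v_1+v_2,\,w_1+w_2)\\ &+\tfrac12\,|v_2\wedge(w_1+w_2)|+|v_1\wedge v_2\wedge(w_1+w_2)|\\ &+|w_1\wedge w_2\wedge v_2|+|v_1\wedge w_1\wedge(v_2+w_2)| \pmod 2 . \end{align*}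
   Context: $\mathbb{F}_2=\{0,1\}$ is the field with two elements. For $v,w\in(\mathbb{F}_2)^n$, $v\wedge w:=(v_1w_1,\dots,v_nw_n)\in(\mathbb{F}_2)^n$ is the coordinatewise product (bitwise AND), and $|v|\in\mathbb{Z}_{\ge0}$ is the weight of $v$, i.e. the number of nonzero entries of $v$. A code is a linear subspace $\mathcal{C}\subset(\mathbb{F}_2)^n$ (not necessarily closed under $\wedge$). It is doubly even if $|v|$ is divisible by $4$ for every $v\in\mathcal{C}$; in that case $|v\wedge w|$ is even for all $v,w\in\mathcal{C}$, so $\tfrac14|v|$ and $\tfrac12|v\wedge w|$ are integers. A code cocycle on a doubly even code $\mathcal{C}$ is a function $\theta\colon\mathcal{C}\times\mathcal{C}\to\mathbb{F}_2$ satisfying, for all $u,v,w\in\mathcal{C}$, (i) $\theta(v,w)-\theta(u+v,w)+\theta(u,v+w)-\theta(u,v)\equiv|u\wedge v\wedge w| \pmod 2$; (ii) $\theta(v,w)+\theta(w,v)\equiv\tfrac12|v\wedge w| \pmod 2$; (iii) $\theta(v,v)\equiv\tfrac14|v| \pmod 2$. *)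

(* Defs.v *)
From mathcomp Require Import all_boot all_order all_algebra.

Set Implicit Arguments.
Unset Strict Implicit.
Unset Printing Implicit Defensive.

Import GRing.Theory.
Local Open Scope ring_scope.

(* A code of length n is a subspace [C : {vspace 'rV['F_2]_n}]; a codeword is
   an element of the vector space [subvs_of C], with [vsval : subvs_of C ->
   'rV['F_2]_n] the inclusion. *)

Definition wedge (n : nat) (v w : 'rV['F_2]_n) : 'rV['F_2]_n :=
  \row_(i < n) (v 0 i * w 0 i).

Definition wt (n : nat) (v : 'rV['F_2]_n) : nat :=
  #|[set i : 'I_n | v 0 i != 0]|.

Definition doubly_even (n : nat) (C : {vspace 'rV['F_2]_n}) : Prop :=
  forall v : 'rV['F_2]_n, v \in C -> (4 %| wt v)%N.

(* Congruences modulo 2 are equalities in 'F_2, natural numbers being cast by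
   [_%:R]. The quotients by 2 and 4 are exact when [C] is doubly even. *)
Record code_cocycle (n : nat) (C : {vspace 'rV['F_2]_n})
    (theta : subvs_of C -> subvs_of C -> 'F_2) : Prop := CodeCocycle {
  code_cocycle_coboundary : forall u v w : subvs_of C,
    theta v w - theta (u + v) w + theta u (v + w) - theta u v
      = (wt (wedge (wedge (vsval u) (vsval v)) (vsval w)))%:R;
  code_cocycle_symm : forall v w : subvs_of C,
    theta v w + theta w v = (wt (wedge (vsval v) (vsval w)) %/ 2)%:R;
  code_cocycle_diag : forall v : subvs_of C,
    theta v v = (wt (vsval v) %/ 4)%:R
}.

(* Main.v *)
Require Import Defs.
From mathcomp Require Import all_boot all_order all_algebra.
From mathcomp Require Import ring.

Import GRing.Theory.
Local Open Scope ring_scope.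

(** The right-hand side is what comes out of reassociating the sum
    v1 + w1 + v2 + w2 with the cocycle relation, whose defect on the triple
    (u, v, w) is |u /\ v /\ w|.  Moving w1 to the right of v1 gives
    theta(v1 + w1, v2 + w2) in terms of theta(v1, v2 + (w1 + w2)) and
    theta(w1, w2 + v2), with defect on (v1, w1, v2 + w2); reassociating these
    two gives defects on (v1, v2, w1 + w2) and (w1, w2, v2), the values of
    theta that appear in the formula, and the leftover
    theta(v2, w1 + w2) + theta(w1 + w2, v2).  By the symmetry relation that
    leftover is |v2 /\ (w1 + w2)| / 2. *)

Lemma oppr_F2 (x : 'F_2) : - x = x.
Proof. exact: (oppr_pchar2 (pchar_Fp (isT : prime 2))). Qed.

(** Signs vanish in characteristic 2, so the cocycle relation can be solved for
    either of its two terms with a sum as argument: this lemma moves [v] out of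
    the left argument, the next one out of the right argument. *)
Lemma code_cocycle_addl {n : nat} {C : {vspace 'rV['F_2]_n}}
    {theta : subvs_of C -> subvs_of C -> 'F_2} (htheta : code_cocycle theta)
    (u v w : subvs_of C) :
  theta (u + v) w = theta v w + theta u (v + w) + theta u v
    + (wt (wedge (wedge (vsval u) (vsval v)) (vsval w)))%:R.
Proof.
rewrite -(oppr_F2 (theta u v)) -(oppr_F2 (wt _)%:R).
by rewrite -(code_cocycle_coboundary htheta); ring.
Qed.

Lemma code_cocycle_addr {n : nat} {C : {vspace 'rV['F_2]_n}}
    {theta : subvs_of C -> subvs_of C -> 'F_2} (htheta : code_cocycle theta)
    (u v w : subvs_of C) :
  theta u (v + w) = theta v w + theta (u + v) w + theta u v
    + (wt (wedge (wedge (vsval u) (vsval v)) (vsval w)))%:R.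
Proof.
rewrite -(oppr_F2 (theta v w)) -(code_cocycle_coboundary htheta).
by ring.
Qed.

Theorem lemma2 (n : nat) (hn : (1 <= n)%N)
    (C : {vspace 'rV['F_2]_n}) (hC : doubly_even C)
    (theta : subvs_of C -> subvs_of C -> 'F_2) (htheta : code_cocycle theta)
    (V W : {vspace subvs_of C})
    (hVW : (V + W)%VS = fullv) (hdirect : directv (V + W))
    (v1 v2 w1 w2 : subvs_of C)
    (hv1 : v1 \in V) (hv2 : v2 \in V) (hw1 : w1 \in W) (hw2 : w2 \in W) :
  theta (v1 + w1) (v2 + w2) =
    theta v1 v2 + theta w1 w2 + theta v1 w1 + theta w2 v2
    + theta (v1 + v2) (w1 + w2)
    + (wt (wedge (vsval v2) (vsval (w1 + w2))) %/ 2)%:R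
    + (wt (wedge (wedge (vsval v1) (vsval v2)) (vsval (w1 + w2))))%:R
    + (wt (wedge (wedge (vsval w1) (vsval w2)) (vsval v2)))%:R
    + (wt (wedge (wedge (vsval v1) (vsval w1)) (vsval (v2 + w2))))%:R.
Proof.
rewrite (code_cocycle_addl htheta v1 w1).
have -> : w1 + (v2 + w2) = v2 + (w1 + w2) by rewrite addrCA.
rewrite (code_cocycle_addr htheta v1 v2) [in theta w1 _](addrC v2 w2).
rewrite (code_cocycle_addr htheta w1 w2 v2).
rewrite -(code_cocycle_symm htheta v2 (w1 + w2)).
by ring.
Qed.
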